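(* Let $q$ be an indeterminate and let $m,n,r\geq 0$ and $k\ge0$ be integers. Then $$L^{(r)}_q(m+n,k)=\sum_{i=0}^n \sum_{j=0}^k q^{i(j+m+2r)}[j+m+2r]_q ^{\overline{n-i}}\binom{n}{i}_qL_q^{(r)}(m,j)\,L_q(i,k-j)$$ and $$L^{(r)}_q(m+n)=\sum_{i=0}^n \sum_{j=0}^m q^{i(j+m+2r)}[j+m+2r]_q ^{\overline{n-i}}\binom{n}{i}_qL_q^{(r)}(m,j)\,L_q(i).$$
   Context: For an integer $a\ge1$, $a_q=[a]_q=1+q+\cdots+q^{a-1}$, $0_q=0$, $a_q!=\prod_{i=1}^a i_q$, $0_q!=1$. The $q$-binomial coefficient is $\binom{n}{k}_q=\frac{n_q!}{k_q!(n-k)_q!}$ for $0\le k\le n$, $\binom{n}{0}_q=1$ for all integers $n$, and $0$ otherwise. The $q$-rising factorial is $[a]_q^{\overline{b}}=\prod_{i=a}^{a+b-1}i_q$ for $b\ge1$ and $[a]_q^{\overline{0}}=1$. A Lah distribution of a finite set of positive integers is a partition of it into nonempty blocks in which each block is linearly ordered (written as a word). For a Lah distribution $\delta$ with $k$ blocks, write the blocks as words $W_1,W_2,\dots,W_k$ arranged in decreasing order of their least elements and let $\mathrm{inv}_\rho(\delta)$ be the number of inversions (pairs of positions $s<t$ with the letter at $s$ larger than the letter at $t$) of the single word $W_1\,0\,W_2\,0\cdots 0\,W_k$ (commas replaced by the letter $0$). Let $L_q(n,k)=\sum_\delta q^{\mathrm{inv}_\rho(\delta)}$ over all Lah distributions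 $\delta$ of $[n]$ with $k$ blocks (so $L_q(0,0)=1$ and $L_q(n,k)=0$ if $k>n$ or $k<0$), and $L_q(n)=\sum_{k=0}^nL_q(n,k)$. For $r\ge0$, let $\mathcal{L}^{(r)}_{n,k}$ be the set of Lah distributions of $[n+r]$ into $k+r$ blocks in which $1,\dots,r$ lie in distinct blocks, $L_q^{(r)}(n,k)=\sum_{\delta\in\mathcal{L}^{(r)}_{n,k}}q^{\mathrm{inv}_\rho(\delta)}$ (zero if $k>n$ or $k<0$), and $L_q^{(r)}(n)=\sum_{k=0}^nL_q^{(r)}(n,k)$. *)

(* Defs.v *)
From HB Require Import structures.
From mathcomp Require Import all_boot all_order all_algebra.

Set Implicit Arguments.
Unset Strict Implicit.
Unset Printing Implicit Defensive.

Import GRing.Theory.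
Local Open Scope ring_scope.

(* The indeterminate q is 'X in {poly int}. *)

Definition qnat (a : nat) : {poly int} := \sum_(i < a) 'X^i.

Definition qfact (a : nat) : {poly int} := \prod_(1 <= i < a.+1) qnat i.

(* The divisor is monic, so %/ is Euclidean division; it is exact by
   qbinom_fact below. *)
Definition qbinom (n k : nat) : {poly int} :=
  if (k <= n)%N then qfact n %/ (qfact k * qfact (n - k)) else 0.

Definition qrising (a b : nat) : {poly int} := \prod_(a <= i < a + b) qnat i.

(* The number i : 'I_N stands for the letter i + 1 of [N] = {1, ..., N}; a block
   is a word without repeated letters, hence of length at most N. *)
Definition lah_block (N : nat) : finType := {bseq N of 'I_N}.

Definition letters (N : nat) (w : lah_block N) : {set 'I_N} := [set x in w].

Definition is_lah (N : nat) (d : {set lah_block N}) : bool :=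
  [&& [forall w in d, uniq w],
      dinjectiveb (@letters N) [in d] &
      partition [set letters w | w in d] [set: 'I_N]].

Definition word (N : nat) (w : lah_block N) : seq nat :=
  [seq (val x).+1 | x <- w].

Definition least (w : seq nat) : nat := foldr minn (head 0%N w) w.

Definition inversions (w : seq nat) : nat :=
  #|[set p : 'I_(size w) * 'I_(size w)
      | (p.1 < p.2)%N && (nth 0%N w p.2 < nth 0%N w p.1)%N]|.

Definition ordered_blocks (N : nat) (d : {set lah_block N}) : seq (seq nat) :=
  sort (fun u v => (least v <= least u)%N) [seq word w | w <- enum d].

(* W_1 0 W_2 0 ... 0 W_k *)
Definition lah_word (N : nat) (d : {set lah_block N}) : seq nat :=
  behead (flatten [seq 0%N :: w | w <- ordered_blocks d]).

Definition inv_rho (N : nat) (d : {set lah_block N}) : nat :=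
  inversions (lah_word d).

Definition lahq (n k : nat) : {poly int} :=
  \sum_(d : {set lah_block n} | is_lah d && (#|d| == k)) 'X^(inv_rho d).

Definition lahq_tot (n : nat) : {poly int} := \sum_(k < n.+1) lahq n k.

Definition distinct_blocks (N r : nat) (d : {set lah_block N}) : bool :=
  [forall w in d, forall x in letters w, forall y in letters w,
    ((x < r)%N && (y < r)%N) ==> (x == y)].

Definition rlah (r n k : nat) : {set {set lah_block (n + r)}} :=
  [set d | [&& is_lah d, #|d| == (k + r)%N & distinct_blocks r d]].

Definition rlahq (r n k : nat) : {poly int} :=
  \sum_(d in rlah r n k) 'X^(inv_rho d).

Definition rlahq_tot (r n : nat) : {poly int} := \sum_(k < n.+1) rlahq r n k.

Lemma qnatD a b : qnat (a + b) = qnat a + 'X^a * qnat b.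
Proof.
rewrite /qnat big_split_ord /=; congr (_ + _).
by rewrite mulr_sumr; apply: eq_bigr => i _; rewrite exprD.
Qed.

Lemma qfact0 : qfact 0 = 1.
Proof. by rewrite /qfact big_geq. Qed.

Lemma qfactS n : qfact n.+1 = qfact n * qnat n.+1.
Proof. by rewrite /qfact big_nat_recr. Qed.

Lemma monic_qnat a : qnat a.+1 \is monic.
Proof.
rewrite /qnat big_ord_recr /= addrC monicE lead_coefDl ?lead_coefXn //.
rewrite size_polyXn ltnS; apply: (leq_trans (size_sum _ _ _)).
by apply/bigmax_leqP => i _; rewrite size_polyXn.
Qed.

Lemma monic_qfact n : qfact n \is monic.
Proof.
elim: n => [|n IHn]; first by rewrite qfact0 monic1.
by rewrite qfactS monicMr ?monic_qnat.
Qed.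

Lemma qfact_dvd a b :
  exists g : {poly int}, qfact (a + b) = g * (qfact a * qfact b).
Proof.
have [s] := ubnP (a + b)%N; elim: s a b => // s IHs [|a] [|b] les.
- by exists 1; rewrite qfact0 !mulr1.
- by exists 1; rewrite qfact0 !mul1r.
- by exists 1; rewrite addn0 qfact0 mulr1 mul1r.
rewrite ltnS addSn in les; have [g Eg] := IHs a b.+1 les.
have [h Eh] : exists h : {poly int},
    qfact (a + b.+1) = h * (qfact a.+1 * qfact b).
  by rewrite -addSnnS; apply: IHs; rewrite addSnnS.
exists (g + h * 'X^(a.+1)).
rewrite addSn qfactS -addSn qnatD mulrDr {1}Eg Eh [RHS]mulrDl.
congr (_ + _); first by rewrite -mulrA [qfact a.+1]qfactS mulrAC.
by rewrite mulrACA [qfact b.+1]qfactS -[qfact a.+1 * qfact b * _]mulrA.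
Qed.

Lemma qbinom_fact n k : (k <= n)%N ->
  qbinom n k * (qfact k * qfact (n - k)) = qfact n.
Proof.
move=> lekn; rewrite /qbinom lekn; have [g] := qfact_dvd k (n - k).
by rewrite subnKC // => ->; rewrite Pdiv.IdomainMonic.mulpK // rpredM ?monic_qfact.
Qed.

(* Main.v *)
Require Import Defs.
From mathcomp Require Import all_boot all_order all_algebra.
From mathcomp Require Import ring zify.

Set Implicit Arguments.
Unset Strict Implicit.
Unset Printing Implicit Defensive.

Import GRing.Theory.
Local Open Scope ring_scope.

(* Inserting the letter N + 1 into a Lah distribution of [N] with K blocks,
   viewed as the word W_1 0 W_2 0 ... 0 W_K of length N + K - 1, is possible at
   each of its N + K gaps, and creates one inversion per letter on the right;
   as a new singleton block it comes first and creates N + K inversions. Hence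
     L^(r)(n + 1, k)
       = q^(n + k - 1 + 2 r) L^(r)(n, k - 1) + [n + k + 2 r] L^(r)(n, k).
   For fixed j the inner sum over i on the right-hand side satisfies the same
   recurrence in n, term by term, by the Pascal rule
     binom(n + 1, i + 1) = binom(n, i + 1) + q^(n - i) binom(n, i)
   and [c + n + a] = [c + n - i] + q^(c + n - i) [i + a]; so both sides of the
   first identity agree by induction on n. The second one is its sum over k. *)

(** * Inversions *)

(** Grouping the inversions by their left letter makes the count structural in the word, as the
    insertion arguments require. *)
Fixpoint word_inv (w : seq nat) : nat :=
  if w is x :: w' then (count (ltn^~ x) w' + word_inv w')%N else 0%N.

Lemma inversionsE w : inversions w = word_inv w.
Proof.
pose I (s : seq nat) := (\sum_(i < size s) \sum_(j < size s)
  ((i < j) && (nth 0 s j < nth 0 s i)))%N.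
have -> : inversions w = I w.
  rewrite /inversions -sum1_card big_mkcond /I pair_bigA /=.
  by apply: eq_bigr => p _; rewrite inE; case: ifP.
elim: w => [|x w IHw]; first by rewrite /I big_ord0.
(* Row 0 of the double sum counts the letters smaller than [x]; column 0 vanishes, since no position
   precedes position 0. *)
rewrite /I /= big_ord_recl big_ord_recl /= add0n -IHw; congr addn.
  rewrite -sum1_count (big_nth 0) big_mkord [RHS]big_mkcond /=.
  by apply: eq_bigr => i _; case: ifP.
apply: eq_bigr => i _; rewrite big_ord_recl /= add0n.
by apply: eq_bigr => j _.
Qed.

(** The last sum, over pairs across the junction, depends on [v] only up to reordering; [sum_insb]
    relies on this. *)
Lemma word_inv_cat u v :
  word_inv (u ++ v) =
    (word_inv u + word_inv v + \sum_(x <- u) count (ltn^~ x) v)%N.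
Proof.
elim: u => [|x u IHu] /=; first by rewrite big_nil addn0.
rewrite IHu count_cat big_cons.
by move: (count _ u) (count _ v) (\sum_(_ <- _) _)%N => a b c; lia.
Qed.

(** * Insertion of a letter *)

Fixpoint insw (x : nat) (w : seq nat) : seq (seq nat) :=
  if w is y :: w' then (x :: w) :: [seq y :: u | u <- insw x w']
  else [:: [:: x]].

(** Only existing blocks receive [x]; opening a new block is treated separately in [lahs]. *)
Fixpoint insb (x : nat) (B : seq (seq nat)) : seq (seq (seq nat)) :=
  if B is w :: B' then
    [seq u :: B' | u <- insw x w] ++ [seq w :: C | C <- insb x B']
  else [::].

(* Blocks that become empty are dropped, so that [dels] also undoes the addition
   of the singleton block [:: x]. *)
Definition dels (x : nat) (B : seq (seq nat)) : seq (seq nat) :=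
  [seq w <- [seq [seq y <- w | y != x] | w <- B] | w != [::]].

Lemma mem_insw x p1 p2 : p1 ++ x :: p2 \in insw x (p1 ++ p2).
Proof.
elim: p1 => [|y p1 IHp] /=; last by rewrite inE map_f ?orbT.
by case: p2 => [|y p2] /=; rewrite inE eqxx.
Qed.

Lemma inswP x w u : u \in insw x w ->
  exists p1 p2, w = p1 ++ p2 /\ u = p1 ++ x :: p2.
Proof.
elim: w u => [|y w IHw] u /=; first by rewrite inE => /eqP->; exists [::], [::].
rewrite inE => /orP[/eqP-> | /mapP[u' /IHw[p1 [p2 [-> ->]]] ->]].
  by exists [::], (y :: w).
by exists (y :: p1), p2.
Qed.

Lemma insw_perm x w u : u \in insw x w -> perm_eq u (x :: w).
Proof.
by case/inswP => p1 [p2 [-> ->]]; rewrite -cat1s perm_catCA.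
Qed.

Lemma insw_uniq x w : x \notin w -> uniq (insw x w).
Proof.
elim: w => //= y w IHw; rewrite inE negb_or => /andP[nxy xNw].
rewrite map_inj_uniq ?IHw ?andbT //; last by move=> u v [].
by apply/mapP => -[u _ [exy _]]; rewrite exy eqxx in nxy.
Qed.

Lemma mem_insb x B1 B2 w u : u \in insw x w ->
  B1 ++ u :: B2 \in insb x (B1 ++ w :: B2).
Proof.
move=> uP; elim: B1 => [|v B1 IHB] /=; rewrite mem_cat map_f ?orbT //.
Qed.

Lemma insbP x B C : C \in insb x B ->
  exists B1 B2 w u,
    [/\ u \in insw x w, B = B1 ++ w :: B2 & C = B1 ++ u :: B2].
Proof.
elim: B C => //= w B IHB C; rewrite mem_cat => /orP[] /mapP[u uP ->].
  by exists [::], B, w, u.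
have [B1 [B2 [v [v' [v'P -> ->]]]]] := IHB _ uP.
by exists (w :: B1), B2, v, v'.
Qed.

(** The first block tells the two halves apart: it contains [x] in one and not in the other. *)
Lemma insb_uniq x B : x \notin flatten B -> uniq (insb x B).
Proof.
elim: B => //= w B IHB; rewrite mem_cat negb_or => /andP[xNw xNB].
rewrite cat_uniq !map_inj_uniq ?insw_uniq ?IHB //; try by move=> ? ? [].
rewrite andbT; apply/hasPn => _ /mapP[C _ ->].
apply/mapP => -[u /insw_perm/perm_mem/(_ x)]; rewrite inE eqxx => xu [ewu _].
by rewrite ewu xu in xNw.
Qed.

Lemma insb_flatten x B C : C \in insb x B ->
  perm_eq (flatten C) (x :: flatten B).
Proof.
case/insbP => B1 [B2 [w [u [/insw_perm uP -> ->]]]].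
rewrite !flatten_cat /= -cat1s perm_sym perm_catCA perm_sym perm_cat2l.
by rewrite catA perm_cat2r.
Qed.

Lemma insb_size x B C : C \in insb x B -> size C = size B.
Proof.
by case/insbP => B1 [B2 [w [u [_ -> ->]]]]; rewrite !size_cat.
Qed.

Lemma dels_id x B : x \notin flatten B -> [::] \notin B -> dels x B = B.
Proof.
rewrite /dels; elim: B => //= w B IHB.
rewrite mem_cat inE !negb_or => /andP[xNw xNB] /andP[nw nB].
rewrite (all_filterP _); last first.
  by apply/allP => y yw; apply: contraNneq xNw => <-.
by rewrite eq_sym nw IHB.
Qed.

(** Deletion recovers the parent from each of its children, which is how [lahs_uniq] excludes
    duplicates. *)
Lemma dels_insb x B C : x \notin flatten B -> [::] \notin B ->
  C \in insb x B -> dels x C = B.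
Proof.
move=> xNB nB /insbP[B1 [B2 [w [u [/inswP[p1 [p2 [ew eu]]] eB ->]]]]].
rewrite -[RHS](dels_id xNB nB) eB /dels !map_cat !filter_cat /=.
by rewrite eu ew !filter_cat /= eqxx.
Qed.

(** * Lists of blocks of Lah distributions *)

(* All lists of blocks [ordered_blocks d] for the Lah distributions d of [N];
   a new singleton block [:: N] has the largest least element, so it is first. *)
Fixpoint lahs (N : nat) : seq (seq (seq nat)) :=
  if N is N'.+1 then
    flatten [seq ([:: N] :: B) :: insb N B | B <- lahs N']
  else [:: [::]].

(** Intrinsic description of the lists produced by [lahs] and by [ordered_blocks], through which the
    two are matched. Disjoint nonempty blocks have distinct least letters, so the weak order already
    fixes the list. *)
Definition valid (N : nat) (B : seq (seq nat)) : bool :=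
  [&& perm_eq (flatten B) (iota 1 N), [::] \notin B &
      sorted geq [seq least w | w <- B]].

Lemma least_mem w : w != [::] -> least w \in w.
Proof.
rewrite /least; case: w => //= x w _.
have: foldr minn x w \in x :: w.
  elim: w => [|y w IHw] /=; first exact: mem_head.
  case: leqP => _; first by rewrite !inE eqxx orbT.
  by move: IHw; rewrite !inE => /orP[->|->]; rewrite ?orbT.
by case: leqP => // _ _; rewrite mem_head.
Qed.

Lemma least_le w x : x \in w -> (least w <= x)%N.
Proof.
rewrite /least; move: (head _ _) => h.
by elim: w => //= y w IHw; rewrite inE geq_min => /orP[/eqP->|/IHw->];
  rewrite ?leqnn ?orbT.
Qed.

Lemma least_eq w x : x \in w -> (forall y, y \in w -> (x <= y)%N) ->
  least w = x.
Proof.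
move=> xw xle; apply/eqP; rewrite eqn_leq least_le //= xle // least_mem //.
by case: w xw {xle}.
Qed.

(** Hence inserting a largest letter leaves the order of the blocks unchanged. The empty word is
    excluded: its [least] is the default 0. *)
Lemma least_insw x w u : w != [::] -> (forall y, y \in w -> (y < x)%N) ->
  u \in insw x w -> least u = least w.
Proof.
move=> nw ltx /insw_perm/perm_mem eu; apply: least_eq => [|y].
  by rewrite eu inE least_mem ?orbT.
rewrite eu inE => /orP[/eqP->|/least_le //].
by apply/ltnW/ltx/least_mem.
Qed.

Lemma least1 x : least [:: x] = x.
Proof. by rewrite /least /= minnn. Qed.

Section Valid.

Variables (N : nat) (B : seq (seq nat)).
Hypothesis vB : valid N B.

Lemma valid_mem x : (x \in flatten B) = (0 < x <= N)%N.
Proof.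
have /and3P[/perm_mem-> _ _] := vB.
by rewrite mem_iota add1n ltnS.
Qed.

Lemma valid_lt x : x \in flatten B -> (x < N.+1)%N.
Proof. by rewrite valid_mem ltnS => /andP[]. Qed.

Lemma valid_notin : N.+1 \notin flatten B.
Proof. by rewrite valid_mem ltnn. Qed.

Lemma valid_nonempty : [::] \notin B.
Proof. by case/and3P: vB. Qed.

Lemma valid_uniq_flatten : uniq (flatten B).
Proof. by have /and3P[/perm_uniq-> _ _] := vB; rewrite iota_uniq. Qed.

Lemma valid_size_flatten : size (flatten B) = N.
Proof. by have /and3P[/perm_size-> _ _] := vB; rewrite size_iota. Qed.

Lemma perm_iotaS s : perm_eq s (iota 1 N) ->
  perm_eq (N.+1 :: s) (iota 1 N.+1).
Proof.
move=> sP; rewrite -[X in iota 1 X]addn1 iotaD add1n -cat1s perm_catC.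
by rewrite perm_cat2r.
Qed.

Lemma valid_insb C : C \in insb N.+1 B -> valid N.+1 C.
Proof.
have /and3P[pB nB sB] := vB.
move=> CP; apply/and3P; split.
- by rewrite (perm_trans (insb_flatten CP)) // perm_iotaS.
- have [B1 [B2 [w [u [/insw_perm/perm_size su eB ->]]]]] := insbP CP.
  move: nB; rewrite eB !mem_cat !inE !negb_or => /and3P[-> _ ->] /=.
  by rewrite andbT; case: u su.
have [B1 [B2 [w [u [uP eB ->]]]]] := insbP CP.
have lew : least u = least w.
  apply: least_insw uP.
    by move: nB; rewrite eB mem_cat inE !negb_or eq_sym => /and3P[].
  move=> y yw; apply: valid_lt; rewrite eB flatten_cat /= !mem_cat yw.
  by rewrite orbT.
by move: sB; rewrite eB !map_cat /= lew.
Qed.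

Lemma valid_cons : valid N.+1 ([:: N.+1] :: B).
Proof.
have /and3P[pB nB sB] := vB.
apply/and3P; split; rewrite ?perm_iotaS //=.
rewrite least1 path_min_sorted //; apply/allP => _ /mapP[w wB ->].
apply/ltnW/valid_lt/flattenP; exists w => //; apply: least_mem.
by apply: contraNneq nB => <-.
Qed.

End Valid.

Lemma valid_lahs N B : B \in lahs N -> valid N B.
Proof.
elim: N B => [|N IHN] B /=; first by rewrite inE => /eqP->.
case/flatten_mapP => C /IHN vC; rewrite inE => /orP[/eqP->|].
  exact: valid_cons.
exact: valid_insb.
Qed.

Lemma flatten_uniq_inj (B : seq (seq nat)) u v x : uniq (flatten B) ->
  u \in B -> v \in B -> x \in u -> x \in v -> u = v.
Proof.
elim: B => //= w B IHB; rewrite cat_uniq => /and3P[_ /hasPn wB uB].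
have abs t : t \in B -> x \in t -> x \notin w.
  by move=> tB xt; apply: wB; apply/flattenP; exists t.
rewrite !inE => /orP[/eqP->|uinB] /orP[/eqP->|vinB] xu xv //.
- by rewrite xu in abs; have := abs _ vinB xv.
- by have := abs _ uinB xu; rewrite xv.
- exact: IHB.
Qed.

(** The last insertion is undone by deleting [N.+1]. If its block keeps some letter, [B] arises by
    [insb]; otherwise the block is a singleton, and it must come first. *)
Lemma lahs_valid N B : valid N B -> B \in lahs N.
Proof.
elim: N B => [|N IHN] B vB.
  rewrite /= inE; have := valid_size_flatten vB; have := valid_nonempty vB.
  by case: B {vB} => // -[].
have uB := valid_uniq_flatten vB.
have /and3P[pB nB sB] := vB.
have /flattenP[u uinB xu] : N.+1 \in flatten B by rewrite (valid_mem vB) leqnn.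
apply/flatten_mapP.
have [B1 [B2 eB]] : exists B1 B2, B = B1 ++ u :: B2.
  by case/splitPr: uinB => B1 B2; exists B1, B2.
have [p1 [p2 eu]] : exists p1 p2, u = p1 ++ N.+1 :: p2.
  by case/splitPr: xu => p1 p2; exists p1, p2.
subst u.
have pB' : perm_eq (flatten (B1 ++ (p1 ++ p2) :: B2)) (iota 1 N).
  rewrite -(perm_cons N.+1); apply: perm_trans (perm_trans _ pB) _.
    rewrite perm_sym eB; apply: (@insb_flatten N.+1); apply: mem_insb.
    exact: mem_insw.
  by rewrite perm_sym perm_iotaS.
have [e0|n0] := eqVneq (p1 ++ p2) [::]; last first.
  exists (B1 ++ (p1 ++ p2) :: B2); last first.
    by rewrite inE eB mem_insb ?orbT ?mem_insw.
  apply: IHN; apply/and3P; split=> //.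
    move: nB; rewrite eB !mem_cat !inE !negb_or => /and3P[-> _ ->].
    by rewrite andbT /= eq_sym.
  rewrite eB in sB.
  (* Deleting [N.+1] from a block that stays nonempty preserves its least letter, hence the
     order. *)
  rewrite map_cat /= -(@least_insw N.+1 _ (p1 ++ N.+1 :: p2)) //.
  - by rewrite map_cat in sB.
  - move=> y yp; have : y \in iota 1 N.
      by rewrite -(perm_mem pB') flatten_cat mem_cat /= mem_cat yp orbT.
    by rewrite mem_iota add1n => /andP[].
  - exact: mem_insw.
case: p1 p2 e0 eB uinB xu pB' => // -[] // _ eB uinB xu pB'.
(* A block [v] in front of the singleton would need a least letter of at least [N.+1], but its
   letters are at most [N]. *)
case: B1 eB pB' => [|v B1] eB pB'; last first.
  have vB1 : v \in B by rewrite eB mem_head.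
  have nv : v != [::] by apply: contraNneq nB => <-.
  have : (N.+1 <= least v)%N.
    rewrite -[N.+1]least1; move: sB; rewrite eB /= path_sortedE; last first.
      by move=> a b c /= ab bc; apply: leq_trans bc ab.
    by case/andP => /allP/(_ (least [:: N.+1])) h _; apply: h;
      rewrite map_f // mem_cat mem_head orbT.
  have lv : least v \in flatten (v :: B1 ++ [::] :: B2).
    by rewrite mem_cat least_mem.
  move: lv; rewrite (perm_mem pB') mem_iota add1n => /andP[_].
  by rewrite ltnNge => /negPf->.
exists B2; last by rewrite eB mem_head.
apply: IHN; apply/and3P; split=> //.
  by move: nB; rewrite eB inE negb_or => /andP[].
by move: sB; rewrite eB => /path_sorted.
Qed.

Lemma mem_lahs N B : (B \in lahs N) = valid N B.
Proof. by apply/idP/idP => [/valid_lahs|/lahs_valid]. Qed.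

(** The map [g] recovers the index from any member of [f x], so the lists [f x] are pairwise
    disjoint. *)
Lemma uniq_flatten_map (S T : eqType) (f : S -> seq T) (g : T -> S) s :
  uniq s -> {in s, forall x, uniq (f x)} ->
  {in s, forall x, {in f x, forall y, g y = x}} ->
  uniq (flatten [seq f x | x <- s]).
Proof.
elim: s => //= x s IHs /andP[xNs us] uf gf.
rewrite cat_uniq uf ?mem_head // IHs //=; last first.
- by move=> y ys; apply: gf; rewrite inE ys orbT.
- by move=> y ys; apply: uf; rewrite inE ys orbT.
rewrite andbT; apply/hasPn => z /flatten_mapP[y ys zy].
apply: contra xNs => zx; rewrite -(gf x _ z zx) ?mem_head //.
by rewrite (gf y _ z zy) // inE ys orbT.
Qed.

Lemma lahs_uniq N : uniq (lahs N).
Proof.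
elim: N => //= N IHN; apply: (uniq_flatten_map (g := dels N.+1)) => // B.
  move/valid_lahs => vB; rewrite /= insb_uniq ?(valid_notin vB) // andbT.
  (* The new singleton adds a block, whereas insertion keeps the number of blocks. *)
  apply/negP => /insb_size /= /eqP; rewrite eqn_leq ltnn //.
move/valid_lahs => vB C; rewrite inE => /orP[/eqP->|CP].
  rewrite /dels /= eqxx /=.
  exact: (dels_id (valid_notin vB) (valid_nonempty vB)).
by rewrite (dels_insb (valid_notin vB) (valid_nonempty vB) CP).
Qed.

Lemma flatten_uniq_block (B : seq (seq nat)) b :
  uniq (flatten B) -> b \in B -> uniq b.
Proof.
elim: B => //= w B IHB; rewrite cat_uniq inE => /and3P[uw _ uB].
by case/orP => [/eqP->|/(IHB uB)].
Qed.

(** A repeated block would repeat its least letter; empty blocks are excluded because they leave no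
    trace in the flattening. *)
Lemma flatten_uniq (B : seq (seq nat)) :
  uniq (flatten B) -> [::] \notin B -> uniq B.
Proof.
elim: B => //= w B IHB; rewrite cat_uniq inE negb_or eq_sym.
case/and3P=> _ /hasPn dwB uB /andP[nw nB]; rewrite IHB // andbT.
apply/negP => wB; have lw := least_mem nw.
have /dwB : least w \in flatten B by apply/flattenP; exists w.
by rewrite /= lw.
Qed.

(** * Lah distributions as lists of blocks *)

Section LahDistribution.

Variable N : nat.
Implicit Types (d : {set lah_block N}) (w : lah_block N).

Lemma word_inj : injective (@word N).
Proof.
move=> u v euv; apply/val_inj/(inj_map _ euv) => x y [/val_inj].
exact.
Qed.

Lemma mem_word w (x : 'I_N) : (x.+1 \in word w) = (x \in letters w).
Proof.
rewrite /word (mem_map (f := fun y : 'I_N => (val y).+1)) ?inE //.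
by move=> y z [/val_inj].
Qed.

(** Without repetition, a word over N letters has length at most N and so fits in [lah_block N]; the
    predecessor in [s] sends the letter i + 1 to the ordinal i. *)
Lemma ex_word (b : seq nat) : uniq b -> {subset b <= iota 1 N} ->
  exists w : lah_block N, word w = b.
Proof.
move=> ub sb.
have sizeb : (size b <= N)%N by rewrite -[N](size_iota 1) uniq_leq_size.
pose s : seq 'I_N := pmap (fun x => insub x.-1) b.
have es : [seq (val x).+1 | x <- s] = b.
  rewrite /s; elim: b sb {ub sizeb s} => //= x b IHb sb.
  have := sb x (mem_head _ _); rewrite mem_iota add1n ltnS => xN.
  have ltx : (x.-1 < N)%N by lia.
  rewrite insubT /= IHb; first by congr (_ :: _); lia.
  by move=> y yb; apply: sb; rewrite inE yb orbT.
have sizes : (size s <= N)%N by rewrite -es size_map in sizeb.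
by exists (Bseq sizes).
Qed.

Lemma perm_ordered_blocks d :
  perm_eq (ordered_blocks d) [seq word w | w <- enum d].
Proof. by rewrite /ordered_blocks perm_sort. Qed.

Lemma mem_ordered_blocks d w : (word w \in ordered_blocks d) = (w \in d).
Proof.
by rewrite (perm_mem (perm_ordered_blocks d)) (mem_map word_inj) mem_enum.
Qed.

Lemma ordered_blocks_inj : injective (@ordered_blocks N).
Proof.
by move=> d e ede; apply/setP => w; rewrite -!mem_ordered_blocks ede.
Qed.

Lemma size_ordered_blocks d : size (ordered_blocks d) = #|d|.
Proof. by rewrite size_sort size_map cardE. Qed.

Lemma valid_ordered_blocks d : is_lah d -> valid N (ordered_blocks d).
Proof.
case/and3P => /forall_inP ud /dinjectiveP injd /and3P[/eqP cd td n0d].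
have pd := perm_ordered_blocks d.
have mem1 (x : 'I_N) : x.+1 \in flatten (ordered_blocks d).
  have : x \in cover [set letters w | w in d] by rewrite cd inE.
  case/bigcupP => _ /imsetP[w wd ->] xw.
  by apply/flattenP; exists (word w); rewrite ?mem_ordered_blocks ?mem_word.
apply/and3P; split.
- have sub : {subset iota 1 N <= flatten (ordered_blocks d)}.
    move=> x; rewrite mem_iota add1n ltnS => xN.
    have ltx : (x.-1 < N)%N by lia.
    by have := mem1 (Ordinal ltx); rewrite /= prednK //; lia.
  (* The block lengths are the cardinals of the letter sets, which add up to N by the partition. A
     list containing [iota 1 N] and no longer than it is a permutation of it. *)
  have le_size : (size (flatten (ordered_blocks d)) <= size (iota 1 N))%N.
    rewrite (perm_size (perm_flatten pd)) size_flatten size_iota /shape.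
    rewrite -map_comp sumnE big_map big_enum /= -[leqRHS](card_ord N) -cardsT.
    rewrite -cd -(eqP td) big_imset //= leq_sum // => w wd.
    by rewrite size_map cardsE (card_uniqP _) ?ud.
  rewrite perm_sym; apply: uniq_perm; first exact: iota_uniq.
    by rewrite (leq_size_uniq _ sub) ?iota_uniq.
  by case: (uniq_min_size _ sub le_size) => //; exact: iota_uniq.
- rewrite (perm_mem pd); apply/mapP => -[w]; rewrite mem_enum => wd ew.
  case/negP: n0d; apply/imsetP; exists w => //; apply/setP => x.
  by rewrite -mem_word -ew inE.
rewrite sorted_map; apply: sort_sorted => u v.
exact: leq_total.
Qed.

Lemma ordered_blocks_surj B : valid N B ->
  exists2 d : {set lah_block N}, is_lah d & ordered_blocks d = B.
Proof.
move=> vB; have uB := valid_uniq_flatten vB; have nB := valid_nonempty vB.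
have /and3P[pB _ sB] := vB.
have ltB b : b \in B -> b != [::] by move=> bB; apply: contraNneq nB => <-.
have uniqB b : b \in B -> uniq b by apply: flatten_uniq_block.
have exB b : b \in B -> exists w : lah_block N, word w = b.
  move=> bB; apply: ex_word; first exact: uniqB.
  by move=> x xb; rewrite -(perm_mem pB); apply/flattenP; exists b.
have injB (u v : lah_block N) x : word u \in B -> word v \in B ->
    x \in letters u -> x \in letters v -> u = v.
  rewrite -!mem_word => uinB vinB xu xv; apply: word_inj.
  exact: flatten_uniq_inj uB uinB vinB xu xv.
have neB (u : lah_block N) : word u \in B -> exists x, x \in letters u.
  move=> /ltB; rewrite /word /letters => nu.
  case eu: (bseqval u) nu => [|x s] // _; exists x.
  by rewrite inE; change (x \in bseqval u); rewrite eu mem_head.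
pose d := [set w : lah_block N | word w \in B].
have pd : perm_eq [seq word w | w <- enum d] B.
  apply: uniq_perm => [||b].
  - by rewrite (map_inj_uniq word_inj) enum_uniq.
  - exact: flatten_uniq.
  apply/mapP/idP => [[w]|bB]; first by rewrite mem_enum inE => wB ->.
  by have [w ew] := exB b bB; exists w; rewrite // mem_enum inE ew.
exists d; last first.
  have trB : transitive (fun u v => least v <= least u)%N.
    by move=> u v w vu uw; apply: leq_trans uw vu.
  rewrite /ordered_blocks -[RHS](sorted_sort trB); last first.
    by rewrite sorted_map in sB.
  (* Sorting depends only on the multiset of blocks, because two blocks of [B] with the same least
     letter share that letter and so coincide. *)
  apply/perm_sort_inP => // [u v _ _|u v w _ _ _|u v].
  - exact: leq_total.
  - exact: trB.
  rewrite !(perm_mem pd) => uinB vinB; rewrite -eqn_leq => /eqP elst.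
  apply: (flatten_uniq_inj uB uinB vinB (least_mem (ltB _ uinB))).
  by rewrite -elst least_mem ?ltB.
apply/and3P; split.
- apply/forall_inP => w; rewrite inE => /uniqB.
  by rewrite /word map_inj_uniq // => x y [/val_inj].
- apply/dinjectiveP => u v; rewrite !inE => uinB vinB euv.
  by have [x xu] := neB u uinB; apply: (injB u v x); rewrite // -euv.
rewrite /partition; apply/and3P; split.
- apply/eqP/setP => x; rewrite inE; apply/bigcupP.
  have /flattenP[b bB xb] : x.+1 \in flatten B by rewrite (valid_mem vB) /=.
  have [w ew] := exB b bB; exists (letters w); last by rewrite -mem_word ew.
  by apply: imset_f; rewrite inE ew.
- apply/trivIsetP => _ _ /imsetP[u uinB ->] /imsetP[v vinB ->].
  rewrite !inE in uinB vinB; rewrite -setI_eq0; apply: contraNT.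
  case/set0Pn => x; rewrite inE => /andP[xu xv].
  by rewrite (injB u v x).
apply/imsetP => -[w]; rewrite inE => /neB[x xw] ew.
by rewrite -ew inE in xw.
Qed.

(** This form only counts letters inside each block, so it is visibly unaffected by the insertion of
    a letter larger than [r]. *)
Lemma distinct_ordered_blocks r d : is_lah d ->
  distinct_blocks r d =
    all (fun b => count (leq^~ r) b <= 1)%N (ordered_blocks d).
Proof.
case/and3P => /forall_inP ud _ _.
rewrite (perm_all _ (perm_ordered_blocks d)) all_map.
apply/forall_inP/allP => /= [dd w|dd w wd].
  rewrite mem_enum => wd; rewrite count_map; have uw := ud w wd.
  move/forall_inP: (dd w wd) => {}dd.
  rewrite -size_filter.
  move: (filter_uniq (preim (fun x : 'I_N => x.+1) (leq^~ r)) uw).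
  case ef: (filter _ _) => [|x [|y s]] //= /andP[xN _].
  have : all [in filter (fun x : 'I_N => (x < r)%N) w] [:: x; y].
    by rewrite ef /= !inE !eqxx orbT.
  rewrite /= !mem_filter andbT => /andP[/andP[xr xw] /andP[yr yw]].
  have xl : x \in letters w by rewrite inE.
  have yl : y \in letters w by rewrite inE.
  move/forall_inP: (dd x xl) => /(_ y yl); rewrite xr yr /= => /eqP exy.
  by rewrite exy mem_head in xN.
apply/forall_inP => x; rewrite inE => xw.
apply/forall_inP => y; rewrite inE => yw.
apply/implyP => /andP[xr yr]; apply: contraT => nxy.
have := dd w; rewrite mem_enum count_map => /(_ wd).
rewrite leqNgt -size_filter => /negP[].
apply: (@uniq_leq_size _ [:: x; y]); first by rewrite /= inE nxy.
by move=> z; rewrite !inE mem_filter => /orP[]/eqP-> /=; rewrite ?xr ?yr.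
Qed.

(** This turns sums over Lah distributions into sums over a recursively generated list. *)
Lemma perm_lahs :
  perm_eq [seq ordered_blocks d | d <- enum [set d | is_lah d]] (lahs N).
Proof.
apply: uniq_perm => [||B].
- by rewrite (map_inj_uniq ordered_blocks_inj) enum_uniq.
- exact: lahs_uniq.
rewrite mem_lahs; apply/mapP/idP => [[d]|/ordered_blocks_surj[d ld <-]].
  by rewrite mem_enum inE => ld ->; apply: valid_ordered_blocks.
by exists d; rewrite // mem_enum inE.
Qed.

End LahDistribution.

(** * Generating functions *)

(* The leading 0 creates no inversion, so it is kept to make [seps] structural
   in the list of blocks. *)
Definition seps (B : seq (seq nat)) : seq nat :=
  flatten [seq 0%N :: w | w <- B].

Definition dist (r : nat) (B : seq (seq nat)) : bool :=
  all (fun b => count (leq^~ r) b <= 1)%N B.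

(** Here [N] and [K] count all letters and blocks, the distinguished ones included; [rlahqE] makes
    the shift by [r]. *)
Definition lahsq (r N K : nat) : {poly int} :=
  \sum_(B <- lahs N | (size B == K) && dist r B) 'X^(word_inv (seps B)).

Lemma inv_rhoE N (d : {set lah_block N}) :
  inv_rho d = word_inv (seps (ordered_blocks d)).
Proof.
rewrite /inv_rho inversionsE /lah_word /seps.
case: (ordered_blocks d) => //= w B.
by rewrite (eq_count (a2 := pred0)) ?count_pred0.
Qed.

Lemma lahsqE r N K :
  \sum_(d : {set lah_block N} | [&& is_lah d, #|d| == K & distinct_blocks r d])
    'X^(inv_rho d) = lahsq r N K.
Proof.
rewrite /lahsq -(perm_big _ (perm_lahs N)) /= big_map big_enum_cond /=.
apply: eq_big => [d|d _]; last by rewrite inv_rhoE.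
rewrite inE; case: (boolP (is_lah d)) => //= ld.
by rewrite size_ordered_blocks (distinct_ordered_blocks r ld).
Qed.

Lemma rlahqE r n k : rlahq r n k = lahsq r (n + r) (k + r).
Proof.
by rewrite -lahsqE /rlahq; apply: eq_bigl => d; rewrite inE.
Qed.

Lemma lahqE n k : lahq n k = lahsq 0 n k.
Proof.
rewrite -lahsqE /lahq; apply: eq_bigl => d; congr (_ && _).
suff -> : distinct_blocks 0 d by rewrite andbT.
by do 3!apply/forall_inP => ? _.
Qed.

Lemma qnatS n : qnat n.+1 = qnat n + 'X^n.
Proof. by rewrite /qnat big_ord_recr. Qed.

Lemma qnat0 : qnat 0 = 0.
Proof. by rewrite /qnat big_ord0. Qed.

Lemma qnat1 : qnat 1 = 1.
Proof. by rewrite qnatS qnat0 add0r expr0. Qed.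

Lemma seps_insb x B C : C \in insb x B -> perm_eq (seps C) (x :: seps B).
Proof.
case/insbP => B1 [B2 [w [u [/insw_perm/permP uP -> ->]]]].
apply/permP => p; rewrite /seps !map_cat !flatten_cat /= !count_cat /=.
by rewrite !count_cat uP /= !addnA; lia.
Qed.

(** This is the number of gaps for an insertion: one after each letter and one after each 0. *)
Lemma size_seps B : size (seps B) = (size (flatten B) + size B)%N.
Proof.
by elim: B => //= w B IHB; rewrite /seps /= !size_cat -/(seps B) IHB; lia.
Qed.

Lemma word_inv_seps w B :
  word_inv (seps (w :: B)) = word_inv (w ++ seps B).
Proof.
by rewrite /seps /= (eq_count (a2 := pred0)) ?count_pred0.
Qed.

Lemma count_ltn_all x w : (forall y, y \in w -> (y < x)%N) ->
  count (ltn^~ x) w = size w.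
Proof. by move=> ltx; apply/eqP; rewrite -all_count; apply/allP. Qed.

(* Inserting a largest letter creates one inversion per letter on its right. *)
Lemma sum_insw x w t :
  (forall y, y \in w -> (y < x)%N) -> (forall y, y \in t -> (y < x)%N) ->
  \sum_(u <- insw x w) 'X^(word_inv (u ++ t)) =
    'X^(word_inv (w ++ t)) * ('X^(size t) * qnat (size w).+1) :> {poly int}.
Proof.
move=> + ltt; elim: w => [|y w IHw] ltw.
  by rewrite /= big_seq1 /= (count_ltn_all ltt) qnat1 mulr1 addnC exprD.
have yx : (y < x)%N by rewrite ltw ?mem_head.
have ltw' z : z \in w -> (z < x)%N by move=> zw; rewrite ltw // inE zw orbT.
rewrite [insw _ _]/= big_cons big_map.
(* In the remaining words [x] comes after [y] and is larger, so [y] contributes the same inversions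
   as before. *)
under eq_big_seq => u uP.
  rewrite cat_cons /= count_cat (permP (insw_perm uP)) /=.
  rewrite [(x < y)%N]ltnNge (ltnW yx) add0n -count_cat exprD.
  over.
rewrite -mulr_sumr IHw //= yx (count_ltn_all (w := w ++ t)); last first.
  by move=> z; rewrite mem_cat => /orP[/ltw'|/ltt].
by rewrite [in RHS]qnatS size_cat add1n !(exprS, exprD); ring.
Qed.

(** If s is the size of [seps B], insertion into the first block [w] gives q^s [|w| + 1] and
    insertion further right gives [s] by induction; the sum is [s + |w| + 1]. *)
Lemma sum_insb x B : (0 < x)%N -> (forall y, y \in flatten B -> (y < x)%N) ->
  \sum_(C <- insb x B) 'X^(word_inv (seps C)) =
    'X^(word_inv (seps B)) * qnat (size (seps B)) :> {poly int}.
Proof.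
move=> x0; elim: B => [|w B IHB] ltB.
  by rewrite /= big_nil qnat0 mulr0.
have ltw y : y \in w -> (y < x)%N by move=> yw; rewrite ltB //= mem_cat yw.
have {}ltB y : y \in flatten B -> (y < x)%N.
  by move=> yB; rewrite ltB //= mem_cat yB orbT.
have lts y : y \in seps B -> (y < x)%N.
  case/flatten_mapP => v vB; rewrite inE => /orP[/eqP-> //|yv].
  by apply: ltB; apply/flattenP; exists v.
rewrite [insb _ _]/= big_cat !big_map -[LHS]/(_ + _).
under eq_bigr do rewrite word_inv_seps.
rewrite sum_insw //.
under eq_big_seq => C CP.
  rewrite word_inv_seps word_inv_cat.
  (* As [x] exceeds every letter of [w], it creates no inversion with them from the right. *)
  rewrite (eq_big_seq (fun y => count (ltn^~ y) (seps B))); last first.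
    move=> y /ltw yx; rewrite (permP (seps_insb CP)) /=.
    by rewrite [(x < y)%N]ltnNge (ltnW yx).
  rewrite addnAC exprD.
  over.
rewrite -mulr_sumr IHB // [X in _ + X]mulrA -exprD addnAC -word_inv_cat.
rewrite word_inv_seps -mulrDr; congr (_ * _); rewrite addrC -qnatD.
by congr qnat; rewrite /seps /= size_cat -/(seps B); lia.
Qed.

Lemma dist_insb r N B C : (r <= N)%N -> C \in insb N.+1 B ->
  dist r C = dist r B.
Proof.
move=> rN /insbP[B1 [B2 [w [u [/insw_perm/permP uP -> ->]]]]].
by rewrite /dist !all_cat /= uP /= [(N < r)%N]ltnNge rN.
Qed.

Lemma lahsqS r N K : (r <= N)%N ->
  lahsq r N.+1 K =
    (if K is K'.+1 then 'X^(N + K') * lahsq r N K' else 0)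
    + qnat (N + K) * lahsq r N K.
Proof.
move=> rN; rewrite /lahsq /= big_flatten big_map /=.
(* Both terms are written as sums over the parent [B], to be compared with its children: the new
   singleton gives the first term, the insertions the second. *)
have -> : (if K is K'.+1 then 'X^(N + K') * lahsq r N K' else 0) =
    \sum_(B <- lahs N | ((size B).+1 == K) && dist r B)
       'X^(N + size B) * 'X^(word_inv (seps B)).
  case: K => [|K]; first by rewrite big_pred0.
  rewrite /lahsq mulr_sumr; apply: eq_big => // B /andP[/eqP-> _] //.
rewrite mulr_sumr [X in _ = X + _]big_mkcond [X in _ = _ + X]big_mkcond.
rewrite -big_split /=.
apply: eq_big_seq => B; rewrite mem_lahs => vB.
rewrite big_mkcond big_cons -big_mkcond; congr (_ + _).
  have -> : dist r ([:: N.+1] :: B) = dist r B.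
    by rewrite /dist /= addn0 leq_b1.
  case: ifP => // _; rewrite word_inv_seps /= exprD.
  rewrite count_ltn_all ?size_seps ?(valid_size_flatten vB) //.
  move=> y /flatten_mapP[v v_B]; rewrite inE => /orP[/eqP-> //|yv].
  by apply: (valid_lt vB); apply/flattenP; exists v.
rewrite big_seq_cond.
rewrite (eq_bigl (fun C => (C \in insb N.+1 B) && ((size B == K) && dist r B))).
  case: ifP => [/andP[/eqP eK _]|_]; last first.
    by rewrite big_pred0 // => C; rewrite andbF.
  under eq_bigl do rewrite andbT.
  rewrite -big_seq sum_insb //; last by move=> y /(valid_lt vB).
  by rewrite size_seps (valid_size_flatten vB) eK mulrC.
move=> C; case: (boolP (C \in _)) => //= CP.
by rewrite (insb_size CP) (dist_insb rN CP).
Qed.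

Lemma lahsq_gt r N K : (N < K)%N -> lahsq r N K = 0.
Proof.
move=> ltNK; rewrite /lahsq big_seq_cond big_pred0 // => B.
apply/negP => /and3P[]; rewrite mem_lahs => vB /eqP sB _.
have := valid_nonempty vB; have := valid_size_flatten vB.
rewrite -sB in ltNK => szB nB; move: ltNK; rewrite -szB ltnNge => /negP[].
elim: B nB {vB szB sB} => //= w B IHB; rewrite inE negb_or size_cat.
case/andP; case: w => //= x w _ /IHB; lia.
Qed.

(** Pigeonhole: each block contains at most one of the letters 1, ..., r, so there are at least r
    blocks. *)
Lemma lahsq_lt r N K : (K < r <= N)%N -> lahsq r N K = 0.
Proof.
case/andP => ltKr rN; rewrite /lahsq big_seq_cond big_pred0 // => B.
apply/negP => /and3P[]; rewrite mem_lahs => /and3P[pB _ _] /eqP sB dB.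
have cB : (count (leq^~ r) (flatten B) <= size B)%N.
  elim: B dB {pB sB} => //= w B IHB /andP[wr /IHB]; rewrite count_cat; lia.
move: cB; rewrite (permP pB) sB leqNgt => /negP[]; apply: leq_trans ltKr _.
rewrite -(subnKC rN) iotaD count_cat -size_filter (all_filterP _).
  by rewrite size_iota leq_addr.
by apply/allP => x; rewrite mem_iota add1n ltnS => /andP[].
Qed.

(** * Recurrences and the convolution formula *)

Lemma rlahqS r n k :
  rlahq r n.+1 k =
    (if k is k'.+1 then 'X^(n + k' + 2 * r) * rlahq r n k' else 0)
    + qnat (n + k + 2 * r) * rlahq r n k.
Proof.
rewrite !rlahqE addSn lahsqS ?leq_addl //.
have e a : (n + r + (a + r) = n + a + 2 * r)%N by lia.
rewrite e; congr (_ + _); case: k => [|k].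
  (* For k = 0 and positive [r], the recurrence [lahsqS] still has a term with one block fewer than
     [r], which vanishes. *)
  case: r e => // r e; rewrite add0n lahsq_lt ?mulr0 //; lia.
by rewrite addSn rlahqE e.
Qed.

Lemma rlahq_gt r n k : (n < k)%N -> rlahq r n k = 0.
Proof. by move=> ltnk; rewrite rlahqE lahsq_gt // ltn_add2r. Qed.

Lemma lahq_rlahq n k : lahq n k = rlahq 0 n k.
Proof. by rewrite lahqE rlahqE !addn0. Qed.

Lemma lahq_gt n k : (n < k)%N -> lahq n k = 0.
Proof. by rewrite lahq_rlahq; apply: rlahq_gt. Qed.

Lemma lahqS n k :
  lahq n.+1 k =
    (if k is k'.+1 then 'X^(n + k') * lahq n k' else 0)
    + qnat (n + k) * lahq n k.
Proof.
by rewrite !lahq_rlahq rlahqS; case: k => [|k]; rewrite !addn0 // lahq_rlahq.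
Qed.

Lemma lahq00 : lahq 0 0 = 1.
Proof. by rewrite lahqE /lahsq /= big_cons big_nil /= addr0. Qed.

Lemma qbinomn0 n : qbinom n 0 = 1.
Proof.
have := qbinom_fact (leq0n n); rewrite qfact0 mul1r subn0 => e.
by apply: (mulIf (monic_neq0 (monic_qfact n))); rewrite mul1r.
Qed.

Lemma qbinom_gt n k : (n < k)%N -> qbinom n k = 0.
Proof. by rewrite /qbinom ltnNge => /negbTE->. Qed.

(** After multiplication by [k+1]! [n-k]! this becomes [n+1] = [n-k] + q^(n-k) [k+1]. *)
Lemma qbinomS n k : (k <= n)%N ->
  qbinom n.+1 k.+1 = qbinom n k.+1 + 'X^(n - k) * qbinom n k.
Proof.
move=> lekn; have nz a : qfact a != 0 by apply/monic_neq0/monic_qfact.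
apply: (mulIf (mulf_neq0 (nz k.+1) (nz (n - k)%N))).
have := @qbinom_fact n.+1 k.+1 lekn; rewrite subSS => ->.
rewrite mulrDl [in X in _ + X]qfactS.
have -> : 'X^(n - k) * qbinom n k * (qfact k * qnat k.+1 * qfact (n - k)) =
    'X^(n - k) * qnat k.+1 * (qbinom n k * (qfact k * qfact (n - k))) by ring.
rewrite qbinom_fact // qfactS.
(* For k = n both sides are 0: the binomial coefficient by definition, and [n - k] = [0] = 0. *)
have -> : qbinom n k.+1 * (qfact k.+1 * qfact (n - k)) = qfact n * qnat (n - k).
  move: lekn; rewrite leq_eqVlt => /orP[/eqP->|ltkn].
    by rewrite qbinom_gt // subnn qnat0 mulr0 mul0r.
  have -> : qfact (n - k) = qfact (n - k.+1) * qnat (n - k).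
    by rewrite -(subnSK ltkn) qfactS.
  by rewrite -[qfact n](qbinom_fact ltkn); ring.
have -> : (n.+1 = n - k + k.+1)%N by lia.
by rewrite qnatD; ring.
Qed.

(** Inner sum over i of the first identity for fixed j, with c = j + m + 2r and a = k - j, without
    the factor [rlahq r m j]. *)
Definition lah_conv (c n a : nat) : {poly int} :=
  \sum_(i < n.+1) 'X^(i * c) * qrising c (n - i) * qbinom n i * lahq i a.

Lemma qrisingS c n : qrising c n.+1 = qrising c n * qnat (c + n).
Proof. by rewrite /qrising addnS big_nat_recr ?leq_addr. Qed.

Lemma lah_convS c n a :
  lah_conv c n.+1 a =
    (if a is a'.+1 then 'X^(c + n + a') * lah_conv c n a' else 0)
    + qnat (c + n + a) * lah_conv c n a.
Proof.
(* The i-th term of [lah_conv c n.+1 a] without its binomial coefficient; the Pascal rule then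
   regroups the sum along [qbinom n i]. *)
pose g i := 'X^(i * c) * qrising c (n.+1 - i) * lahq i a : {poly int}.
have -> : lah_conv c n.+1 a =
    \sum_(i < n.+1) (g i * qbinom n i + g i.+1 * ('X^(n - i) * qbinom n i)).
  rewrite big_split /=.
  have -> : \sum_(i < n.+1) g i * qbinom n i = \sum_(i < n.+2) g i * qbinom n i.
    by rewrite [RHS]big_ord_recr /= qbinom_gt // mulr0 addr0.
  rewrite [X in _ = X + _]big_ord_recl [LHS]big_ord_recl /= -addrA.
  rewrite -big_split /=.
  congr (_ + _); first by rewrite /g !qbinomn0 !mulr1.
  apply: eq_bigr => i _; rewrite /bump !add1n qbinomS; last by rewrite -ltnS.
  by rewrite -[LHS]mulrAC mulrDr.
have -> : (if a is a'.+1 then 'X^(c + n + a') * lah_conv c n a' else 0) =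
    \sum_(i < n.+1) 'X^(i * c) * qrising c (n - i) * qbinom n i
      * ('X^c * 'X^(n - i)
         * (if a is a'.+1 then 'X^(i + a') * lahq i a' else 0)).
  case: a g => [|a] _.
    by rewrite big1 // => i _; rewrite !mulr0.
  rewrite /lah_conv mulr_sumr; apply: eq_bigr => -[i /= lei] _.
  have -> : (c + n + a = c + (n - i) + (i + a))%N by lia.
  by rewrite !exprD; ring.
rewrite /lah_conv mulr_sumr -big_split /=; apply: eq_bigr => -[i /= lei] _.
rewrite /g subSS subSn // qrisingS lahqS mulSn exprD.
have -> : (c + n + a = c + (n - i) + (i + a))%N by lia.
rewrite [qnat (c + _ + _)]qnatD exprD.
by move: (if a is _.+1 then _ else _) => p; ring.
Qed.

Lemma rlahq_conv m n r k :
  rlahq r (m + n) k =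
    \sum_(j < k.+1) rlahq r m j * lah_conv (j + m + 2 * r) n (k - j).
Proof.
elim: n k => [|n IHn] k.
  have conv0 c a : lah_conv c 0 a = lahq 0 a.
    rewrite /lah_conv big_ord1 mul0n expr0 qbinomn0 /qrising addn0.
    by rewrite big_geq // !mul1r.
  (* Only j = k survives, because [lahq 0 (k - j)] vanishes for j < k. *)
  rewrite addn0 big_ord_recr /= subnn conv0 lahq00 mulr1 big1 ?add0r // => j _.
  by rewrite conv0 lahq_gt ?mulr0 // subn_gt0.
rewrite addnS rlahqS !IHn.
under [RHS]eq_bigr => j _ do rewrite lah_convS mulrDr.
rewrite big_split /=; congr (_ + _); last first.
  (* For c = j + m + 2r one has c + n + (k - j) = m + n + k + 2r, so the factor does not depend on
     [j]. *)
  rewrite mulr_sumr; apply: eq_bigr => -[j /= lej] _; rewrite mulrCA.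
  by do 2!congr (_ * _); congr qnat; lia.
case: k => [|k]; first by rewrite big_ord1 mulr0.
(* The last index j = k + 1 has a = 0, where the shifted term is 0. *)
rewrite big_ord_recr /= subnn mulr0 addr0 IHn mulr_sumr.
apply: eq_bigr => -[j /= lej] _; rewrite subSn // mulrCA.
by congr (_ * (_ * _)); congr ('X^ _); lia.
Qed.

(** Any bound M > n gives the full total, since [lahq i a] vanishes for a > i and i is at most n. *)
Lemma lah_conv_tot c n M : (n < M)%N ->
  \sum_(a < M) lah_conv c n a =
    \sum_(i < n.+1) 'X^(i * c) * qrising c (n - i) * qbinom n i * lahq_tot i.
Proof.
move=> nM; rewrite /lah_conv exchange_big /=; apply: eq_bigr => -[i /= lei] _.
rewrite -mulr_sumr; congr (_ * _); rewrite /lahq_tot.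
rewrite [RHS](big_ord_widen M (lahq i)); last exact: leq_trans lei nM.
rewrite [RHS]big_mkcond; apply: eq_bigr => a _.
by case: ltnP => // /lahq_gt.
Qed.

Theorem theorem2p4 (m n r k : nat) :
  rlahq r (m + n) k =
    \sum_(i < n.+1) \sum_(j < k.+1)
      'X^(i * (j + m + 2 * r)) * qrising (j + m + 2 * r) (n - i) * qbinom n i
      * rlahq r m j * lahq i (k - j)
  /\
  rlahq_tot r (m + n) =
    \sum_(i < n.+1) \sum_(j < m.+1)
      'X^(i * (j + m + 2 * r)) * qrising (j + m + 2 * r) (n - i) * qbinom n i
      * rlahq r m j * lahq_tot i.
Proof.
split.
  rewrite rlahq_conv [RHS]exchange_big /=; apply: eq_bigr => j _.
  by rewrite /lah_conv mulr_sumr; apply: eq_bigr => i _; ring.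
pose F j a := rlahq r m j * lah_conv (j + m + 2 * r) n a.
(* The first identity is summed over k, and the sums over k and j are exchanged. *)
have -> : rlahq_tot r (m + n) =
    \sum_(j < (m + n).+1) \sum_(k < (m + n).+1 | (j <= k)%N) F j (k - j)%N.
  rewrite /rlahq_tot [RHS](exchange_big_dep xpredT) //=; apply: eq_bigr => l _.
  rewrite rlahq_conv (big_ord_widen _ (fun j => F j (l - j)%N) (ltn_ord l)).
  by apply: eq_bigl => j; rewrite ltnS.
rewrite [RHS]exchange_big /=.
(* Both sides become sums over j up to m + n; for j > m the left term vanishes with
   [rlahq r m j]. *)
rewrite (big_ord_widen (m + n).+1 (fun j => \sum_(i < n.+1)
  'X^(i * (j + m + 2 * r)) * qrising (j + m + 2 * r) (n - i) * qbinom n i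
      * rlahq r m j * lahq_tot i)) ?ltnS ?leq_addr //.
rewrite [RHS]big_mkcond; apply: eq_bigr => -[j /= ltj] _.
case: ltnP => [lejm|/rlahq_gt e0]; last first.
  by rewrite big1 // => l _; rewrite /F e0 mul0r.
transitivity (\sum_(a < (m + n).+1 - j) F j a).
  rewrite -(big_mkord xpredT (F j)).
  rewrite -(big_mkord (fun l => j <= l)%N (fun l => F j (l - j)%N)).
  rewrite -(big_nat_widenl j 0 (m + n).+1 xpredT) // -{1}[j]add0n.
  by rewrite big_addn; apply: eq_big_nat => l _; rewrite addnK.
(* As j is at most m, the bound m + n + 1 - j exceeds n, as [lah_conv_tot] requires. *)
rewrite /F -mulr_sumr lah_conv_tot ?mulr_sumr; last by lia.
by apply: eq_bigr => i _; ring.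
Qed.
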